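(* Consider the $K$-user multiple-access relay channel with direct links described in the context, with $\mathbf{h}\neq 0$. Let $R_{\Sigma}^{\mathrm{joint}}(P_r)$ be the optimal sum-rate of the joint relaying scheme and $R_{\Sigma}^{\mathrm{TDMA}}(P_r)$ the sum-rate of the TDMA-based scheme with optimal time slot durations, both for relay power $P_r$. Then, in the limit $P_r\to\infty$, joint relaying achieves a higher sum-rate than TDMA, i.e. $$\lim_{P_r\to\infty} R_{\Sigma}^{\mathrm{joint}}(P_r) > \lim_{P_r\to\infty} R_{\Sigma}^{\mathrm{TDMA}}(P_r),$$ if and only if $$\lambda_{\max}(\mathbf{R}+\mathbf{W}) > \sum_{k=1}^{K}\|\mathbf{h}_r^{(k)}\|^2 P^{(k)}.$$
   Context: Data: integers $K,M_r\ge 1$; vectors $\mathbf{h}_r^{(k)}\in\mathbb{C}^{M_r}$ (user $k$ to relay), scalars $h_d^{(k)}\in\mathbb{C}$ (direct link of user $k$), powers $P^{(k)}\ge 0$, for $k=1,\dots,K$; a vector $\mathbf{h}\in\mathbb{C}^{M_r}$ (relay to receiver channel is $\mathbf{h}^H$); relay power $P_r>0$. $\|\cdot\|$ is the Euclidean norm (absolute value for scalars), $(\cdot)^H$ the conjugate transpose, $\mathbf{I}$ the identity, $\lambda_{\max}$ the largest eigenvalue of a Hermitian matrix. All noise variances equal 1. Matrices: $$\mathbf{R}=\sum_{k=1}^K P^{(k)}\mathbf{h}_r^{(k)}{\mathbf{h}_r^{(k)}}^H,$$ $$\mathbf{W}=\tfrac12\sum_{j,k=1}^K P^{(j)}P^{(k)}\left(h_d^{(k)}\mathbf{h}_r^{(j)}-h_d^{(j)}\mathbf{h}_r^{(k)}\right)\left(h_d^{(k)}\mathbf{h}_r^{(j)}-h_d^{(j)}\mathbf{h}_r^{(k)}\right)^H.$$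 Joint relaying: for a relaying matrix $\mathbf{F}\in\mathbb{C}^{M_r\times M_r}$ put $r=1+\mathbf{h}^H\mathbf{F}\mathbf{F}^H\mathbf{h}$ and $\mathbf{h}_{\mathrm{eff}}^{(k)}=[\,r^{-1/2}\mathbf{h}^H\mathbf{F}\mathbf{h}_r^{(k)},\ h_d^{(k)}]^T\in\mathbb{C}^2$. The sum-rate is $R_\Sigma(\mathbf{F})=\log_2\det\left(\mathbf{I}+\sum_{k=1}^K P^{(k)}\mathbf{h}_{\mathrm{eff}}^{(k)}{\mathbf{h}_{\mathrm{eff}}^{(k)}}^H\right)$, and $R_{\Sigma}^{\mathrm{joint}}(P_r)$ is the supremum of $R_\Sigma(\mathbf{F})$ over all $\mathbf{F}$ with $\mathrm{tr}\left(\mathbf{F}(\mathbf{I}+\mathbf{R})\mathbf{F}^H\right)\le P_r$. TDMA: user $k$ transmits alone, with power $P^{(k)}/\tau^{(k)}$, in a slot of duration $\tau^{(k)}\ge 0$, where $\sum_{k=1}^K\tau^{(k)}=1$. With the optimal relaying matrix in each slot, its rate is $$R^{(k)}(\tau^{(k)})=\tau^{(k)}\log_2\left(1+\frac{\|h_d^{(k)}\|^2P^{(k)}}{\tau^{(k)}}+\frac{\|\mathbf{h}\|^2P^{(k)}\|\mathbf{h}_r^{(k)}\|^2P_r}{\|\mathbf{h}\|^2P_r\tau^{(k)}+P^{(k)}\|\mathbf{h}_r^{(k)}\|^2+\tau^{(k)}}\right)$$ for $\tau^{(k)}>0$, and $R^{(k)}(0)=0$. $R_{\Sigma}^{\mathrm{TDMA}}(P_r)$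 is the maximum of $\sum_{k=1}^K R^{(k)}(\tau^{(k)})$ over all $\tau^{(k)}\ge 0$ with $\sum_{k=1}^K\tau^{(k)}=1$. *)

(* Defs.v *)
From HB Require Import structures.
From mathcomp Require Import all_boot all_order all_algebra.
From mathcomp Require Import all_classical all_reals all_analysis.
From mathcomp Require Import complex.

Set Implicit Arguments.
Unset Strict Implicit.
Unset Printing Implicit Defensive.

Import Order.TTheory GRing.Theory Num.Theory.
Import numFieldNormedType.Exports.

Local Open Scope classical_set_scope.
Local Open Scope ring_scope.
Local Open Scope complex_scope.

Definition log2 (R : realType) (x : R) : R := ln x / ln 2.

Definition cabs (R : realType) (z : R[i]) : R := complex.Re `|z|.

(* The library norm on matrices is the sup norm, hence an explicit Euclidean
   norm. *)
Definition l2norm (R : realType) (n : nat) (v : 'cV[R[i]]_n) : R :=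
  Num.sqrt (\sum_(i < n) cabs (v i 0) ^+ 2).

Definition adjmx (R : realType) (m n : nat) (A : 'M[R[i]]_(m, n)) :
  'M[R[i]]_(n, m) := map_mx Num.conj A^T.

(* Largest real eigenvalue. A Hermitian matrix of positive size has a nonempty
   finite set of eigenvalues, all of them real, so the supremum is a maximum. *)
Definition lambda_max (R : realType) (n : nat) (A : 'M[R[i]]_n) : R :=
  sup [set x : R | eigenvalue A x%:C].

Definition Rmx (R : realType) (K Mr : nat) (hr : 'I_K -> 'cV[R[i]]_Mr)
    (P : 'I_K -> R) : 'M[R[i]]_Mr :=
  \sum_(k < K) (P k)%:C *: (hr k *m adjmx (hr k)).

Definition Wmx (R : realType) (K Mr : nat) (hr : 'I_K -> 'cV[R[i]]_Mr)
    (hd : 'I_K -> R[i]) (P : 'I_K -> R) : 'M[R[i]]_Mr :=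
  2^-1 *: \sum_(j < K) \sum_(k < K)
    (P j * P k)%:C *: ((hd k *: hr j - hd j *: hr k)
                       *m adjmx (hd k *: hr j - hd j *: hr k)).

(* 1 + h^H F F^H h; a complex number that is real and at least 1. *)
Definition relay_noise (R : realType) (Mr : nat) (h : 'cV[R[i]]_Mr)
    (F : 'M[R[i]]_Mr) : R[i] :=
  1 + (adjmx h *m F *m adjmx F *m h) 0 0.

Definition h_eff (R : realType) (K Mr : nat) (hr : 'I_K -> 'cV[R[i]]_Mr)
    (hd : 'I_K -> R[i]) (h : 'cV[R[i]]_Mr) (F : 'M[R[i]]_Mr) (k : 'I_K) :
    'cV[R[i]]_2 :=
  \col_(i < 2) if i == 0 then
                 (sqrtC (relay_noise h F))^-1 * (adjmx h *m F *m hr k) 0 0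
               else hd k.

(* The determinant is that of a Hermitian matrix, hence real; Re only changes
   its type. *)
Definition sum_rate (R : realType) (K Mr : nat) (hr : 'I_K -> 'cV[R[i]]_Mr)
    (hd : 'I_K -> R[i]) (P : 'I_K -> R) (h : 'cV[R[i]]_Mr)
    (F : 'M[R[i]]_Mr) : R :=
  log2 (complex.Re (\det (1%:M + \sum_(k < K) (P k)%:C *:
    (h_eff hr hd h F k *m adjmx (h_eff hr hd h F k))))).

(* The order of R[i] compares real parts and requires equal imaginary parts;
   the trace below is always real. *)
Definition joint_feasible (R : realType) (K Mr : nat)
    (hr : 'I_K -> 'cV[R[i]]_Mr) (P : 'I_K -> R) (Pr : R) :
    set 'M[R[i]]_Mr :=
  [set F | \tr (F *m (1%:M + Rmx hr P) *m adjmx F) <= Pr%:C].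

Definition joint_sum_rate (R : realType) (K Mr : nat)
    (hr : 'I_K -> 'cV[R[i]]_Mr) (hd : 'I_K -> R[i]) (P : 'I_K -> R)
    (h : 'cV[R[i]]_Mr) (Pr : R) : R :=
  sup [set sum_rate hr hd P h F | F in joint_feasible hr P Pr].

Definition tdma_rate (R : realType) (K Mr : nat) (hr : 'I_K -> 'cV[R[i]]_Mr)
    (hd : 'I_K -> R[i]) (P : 'I_K -> R) (h : 'cV[R[i]]_Mr) (Pr : R)
    (k : 'I_K) (tau : R) : R :=
  if tau == 0 then 0 else
  tau * log2 (1 + cabs (hd k) ^+ 2 * P k / tau
              + l2norm h ^+ 2 * P k * l2norm (hr k) ^+ 2 * Pr
                / (l2norm h ^+ 2 * Pr * tau + P k * l2norm (hr k) ^+ 2 + tau)).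

Definition time_allocation (R : realType) (K : nat) : set ('I_K -> R) :=
  [set tau | (forall k, 0 <= tau k) /\ \sum_(k < K) tau k = 1].

(* For K > 0 and Pr > 0 the sum is continuous in tau (also at tau k = 0) on the
   compact simplex of time allocations, so the supremum is a maximum. *)
Definition tdma_sum_rate (R : realType) (K Mr : nat)
    (hr : 'I_K -> 'cV[R[i]]_Mr) (hd : 'I_K -> R[i]) (P : 'I_K -> R)
    (h : 'cV[R[i]]_Mr) (Pr : R) : R :=
  sup [set \sum_(k < K) tdma_rate hr hd P h Pr k (tau k)
      | tau in @time_allocation R K].

(* Main.v *)
(* The sum-rate of joint relaying depends on [F] only through the row
   [u = h^H F]: by Lagrange's identity the determinant equals
   [1 + D + u (R + W) u^H / (1 + |u|^2)] with [D = sum_k P_k |hd_k|^2].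
   Hence it is at most [1 + D + lambda_max (R + W)], and this bound is
   approached by [F = c h v], [v] a left eigenvector for [lambda_max], with [c]
   as large as the power constraint permits. The TDMA rate of user [k] increases
   to [tau log2 (1 + c_k / tau)], [c_k = P_k (|hd_k|^2 + |hr_k|^2)], and concavity
   of the logarithm gives the optimum [log2 (1 + sum_k c_k)], attained for [tau_k]
   proportional to [c_k]. Both limits are thus explicit, and comparing them
   amounts to comparing [lambda_max (R + W)] with [sum_k P_k |hr_k|^2]. *)
Require Import Defs.
From HB Require Import structures.
From mathcomp Require Import all_boot all_order all_algebra.
From mathcomp Require Import all_classical all_reals all_analysis.
From mathcomp Require Import complex.
From mathcomp Require Import ring.

Set Implicit Arguments.
Unset Strict Implicit.
Unset Printing Implicit Defensive.

Import Order.TTheory GRing.Theory Num.Theory.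
Import numFieldNormedType.Exports.

Local Open Scope classical_set_scope.
Local Open Scope ring_scope.
Local Open Scope complex_scope.

(** * Adjoints, positivity, and the largest eigenvalue of a Hermitian matrix *)

Lemma adjmxM (R : realType) m n p (A : 'M[R[i]]_(m, n)) (B : 'M[R[i]]_(n, p)) :
  adjmx (A *m B) = adjmx B *m adjmx A.
Proof. by rewrite /adjmx trmx_mul map_mxM. Qed.

Lemma adjmxK (R : realType) m n (A : 'M[R[i]]_(m, n)) : adjmx (adjmx A) = A.
Proof. by apply/matrixP => i j; rewrite !mxE conjCK. Qed.

Lemma adjmxZ (R : realType) m n (a : R[i]) (A : 'M[R[i]]_(m, n)) :
  adjmx (a *: A) = Num.conj a *: adjmx A.
Proof. by rewrite /adjmx linearZ map_mxZ. Qed.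

Lemma adjmxD (R : realType) m n (A B : 'M[R[i]]_(m, n)) :
  adjmx (A + B) = adjmx A + adjmx B.
Proof. by rewrite /adjmx linearD map_mxD. Qed.

Lemma adjmx_sum (R : realType) m n (I : finType) (A : I -> 'M[R[i]]_(m, n)) :
  adjmx (\sum_i A i) = \sum_i adjmx (A i).
Proof.
by apply/matrixP => i j; rewrite !mxE !summxE rmorph_sum; apply: eq_bigr => k _;
  rewrite !mxE.
Qed.

Lemma conj_real_complex (R : realType) (x : R) : Num.conj x%:C = x%:C.
Proof. exact: conjc_real. Qed.

Lemma real_complex_ge0 (R : realType) (x : R) : 0 <= x -> 0 <= x%:C.
Proof. by move=> x0; rewrite lecE/= eqxx. Qed.

Lemma cabs_sqr (R : realType) (z : R[i]) : (cabs z ^+ 2)%:C = z * Num.conj z.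
Proof. by rewrite rmorphXn /= /cabs RRe_real ?normr_real// normCK. Qed.

Lemma l2norm_sqr (R : realType) n (v : 'cV[R[i]]_n) :
  (l2norm v ^+ 2)%:C = (adjmx v *m v) 0 0.
Proof.
rewrite /l2norm sqr_sqrtr ?sumr_ge0// => [|i _]; last exact: sqr_ge0.
rewrite rmorph_sum mxE; apply: eq_bigr => i _.
by rewrite !mxE -mulrC; exact: cabs_sqr.
Qed.

Lemma mulmx_adj_ge0 (R : realType) n (u : 'rV[R[i]]_n) :
  0 <= (u *m adjmx u) 0 0.
Proof.
by rewrite mxE sumr_ge0// => i _; rewrite !mxE mul_conjC_ge0.
Qed.

Lemma mulmx_adj_gt0 (R : realType) n (u : 'rV[R[i]]_n) :
  u != 0 -> 0 < (u *m adjmx u) 0 0.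
Proof.
move=> u0; rewrite lt_def mulmx_adj_ge0 andbT; apply: contra u0.
rewrite mxE psumr_eq0 => [/allP h|i _]; last by rewrite !mxE mul_conjC_ge0.
apply/eqP/rowP => i; have := h i (mem_index_enum _).
by rewrite !mxE mul_conjC_eq0 => /eqP.
Qed.

Lemma adj_mulmx_gt0 (R : realType) n (v : 'cV[R[i]]_n) :
  v != 0 -> 0 < (adjmx v *m v) 0 0.
Proof.
move=> v0; have := @mulmx_adj_gt0 _ _ (adjmx v); rewrite adjmxK; apply.
by apply: contra v0 => /eqP v00; rewrite -[v]adjmxK v00 /adjmx trmx0 map_mx0.
Qed.

Lemma l2norm_gt0 (R : realType) n (v : 'cV[R[i]]_n) :
  v != 0 -> 0 < l2norm v ^+ 2.
Proof. by move=> v0; rewrite -ltcR l2norm_sqr adj_mulmx_gt0. Qed.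

Lemma mxtrace_mulmx_adj_ge0 (R : realType) m n (A : 'M[R[i]]_(m, n)) :
  0 <= \tr (A *m adjmx A).
Proof.
rewrite /mxtrace sumr_ge0// => i _; rewrite mxE sumr_ge0// => j _.
by rewrite !mxE mul_conjC_ge0.
Qed.

Lemma Re_ge0 (R : realType) (z : R[i]) : 0 <= z -> 0 <= complex.Re z.
Proof. by rewrite lecE => /andP[]. Qed.

(** Spectral theorem: [A = U^-1 diag(d) U] with [U] unitary and [d] real. In the coordinates
    [y = u U^-1] the form is [sum_i d_i |y_i|^2], hence at most [max d] times [|y|^2 = |u|^2]. This
    Rayleigh bound, applied to eigenvectors, also shows that the supremum in [lambda_max] is
    [max d]. *)
Lemma hermitian_lambda_max (R : realType) n (A : 'M[R[i]]_n) :
    (0 < n)%N -> adjmx A = A ->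
  eigenvalue A (lambda_max A)%:C /\
  forall u : 'rV_n, (u *m A *m adjmx u) 0 0 <=
                    (lambda_max A)%:C * (u *m adjmx u) 0 0.
Proof.
move=> n0 Aadj.
have Aherm : A \is hermitianmx n false Num.conj.
  by apply/is_hermitianmxP; rewrite expr0 scale1r -[LHS]Aadj.
have /orthomx_spectralP := hermitian_normalmx Aherm.
set U := spectralmx A; set d := spectral_diag A => AE.
have Uu : U \is unitarymx := spectral_unitarymx A.
have UV : U *m invmx U = 1%:M by rewrite mulmxV// unitarymx_unit.
have adjU : adjmx U = invmx U by rewrite invmx_unitary.
have dreal i : d 0 i \is Num.real.
  by have /mxOverP := hermitian_spectral_diag_real Aherm; apply.
pose D i : R := complex.Re (d 0 i).
have dE i : d 0 i = (D i)%:C by rewrite /D RRe_real.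
have Deig i : eigenvalue A (D i)%:C.
  (* [eigenvalue] refers to left eigenvectors, and these are the rows of [U]. None of them is zero,
     since otherwise [U U^-1 = 1] would have a zero row. *)
  apply/eigenvalueP; exists (row i U).
    rewrite AE -!row_mul !mulmxA UV mul1mx row_mul -dE.
    have -> : row i (diag_mx d) = d 0 i *: delta_mx 0 i by rewrite row_diag_mx.
    by rewrite -scalemxAl -rowE.
  apply/eqP => r0; have /(congr1 (fun M => (row i M) 0 i)) := UV.
  by rewrite row_mul r0 mul0mx !mxE eqxx => /eqP; rewrite eq_sym oner_eq0.
pose i0 := Ordinal n0.
pose m := [arg max_(i > i0) D i]%O.
have mP i : D i <= D m by rewrite /m; case: arg_maxP => // j _; apply.
have ub (u : 'rV_n) :
    (u *m A *m adjmx u) 0 0 <= (D m)%:C * (u *m adjmx u) 0 0.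
  pose y := u *m invmx U.
  have adjy : adjmx y = U *m adjmx u by rewrite /y adjmxM -adjU adjmxK.
  have -> : u *m adjmx u = y *m adjmx y.
    by rewrite adjy /y mulmxA mulmxKV// unitarymx_unit.
  have -> : u *m A *m adjmx u = y *m diag_mx d *m adjmx y.
    by rewrite adjy /y {1}AE !mulmxA.
  rewrite mul_mx_diag !mxE mulr_sumr; apply: ler_sum => i _.
  rewrite !mxE dE mulrAC [leLHS]mulrC ler_wpM2r ?mul_conjC_ge0//.
  by rewrite lecR.
suff -> : lambda_max A = D m by split.
have ubm : ubound [set x : R | eigenvalue A x%:C] (D m).
  move=> x /= /eigenvalueP[v vA v0].
  have := ub v; rewrite vA -scalemxAl mxE ler_pM2r ?mulmx_adj_gt0//.
  by rewrite lecR.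
apply/eqP; rewrite eq_le; apply/andP; split.
  by apply: ge_sup => //; exists (D m) => /=.
by apply: ub_le_sup; [exists (D m)|exact: Deig].
Qed.

(** * Lagrange's identity and the quadratic forms of [Rmx] and [Wmx] *)

(** The left side has the shape of the 2 x 2 determinant in the sum-rate. The families [y] and [e]
    stand for the conjugates of [x] and [d]; as independent variables they make this a polynomial
    identity, provable termwise by [ring]. *)
Lemma lagrange_identity (F : numFieldType) (I : finType) (q x y d e : I -> F) :
  (1 + \sum_k q k * (x k * y k)) * (1 + \sum_k q k * (d k * e k))
   - (\sum_k q k * (x k * e k)) * (\sum_k q k * (d k * y k))
  = 1 + \sum_k q k * (d k * e k) + (\sum_k q k * (x k * y k)
   + 2^-1 * \sum_j \sum_k q j * q k *
       ((d k * x j - d j * x k) * (e k * y j - e j * y k))).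
Proof.
set X := \sum_k q k * (x k * y k); set D := \sum_k q k * (d k * e k).
set Y := \sum_k q k * (x k * e k); set Z := \sum_k q k * (d k * y k).
(* The double sum runs over ordered pairs, so each unordered pair counts twice; this factor 2
   cancels the [2^-1] in the definition of [Wmx]. *)
suff -> : \sum_j \sum_k q j * q k *
    ((d k * x j - d j * x k) * (e k * y j - e j * y k))
    = 2 * (X * D - Y * Z).
  by rewrite mulKf ?pnatr_eq0//; ring.
transitivity (X * D + D * X - Y * Z - Z * Y); last by ring.
rewrite !big_distrlr/= -big_split/= -!sumrB; apply: eq_bigr => j _.
by rewrite -big_split/= -!sumrB; apply: eq_bigr => k _; ring.
Qed.

Lemma quad_outer (R : realType) n (u : 'rV[R[i]]_n) (a : 'cV[R[i]]_n) :
  (u *m (a *m adjmx a) *m adjmx u) 0 0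
  = (u *m a) 0 0 * Num.conj ((u *m a) 0 0).
Proof.
rewrite mulmxA -mulmxA -adjmxM mxE big_ord1; congr (_ * _).
by rewrite !mxE.
Qed.

Lemma quad_Rmx (R : realType) (K Mr : nat) (hr : 'I_K -> 'cV[R[i]]_Mr)
    (P : 'I_K -> R) (u : 'rV[R[i]]_Mr) :
  (u *m Rmx hr P *m adjmx u) 0 0
  = \sum_k (P k)%:C * ((u *m hr k) 0 0 * Num.conj ((u *m hr k) 0 0)).
Proof.
rewrite /Rmx mulmx_sumr mulmx_suml summxE; apply: eq_bigr => k _.
by rewrite -scalemxAr -scalemxAl mxE quad_outer.
Qed.

Lemma quad_Wmx (R : realType) (K Mr : nat) (hr : 'I_K -> 'cV[R[i]]_Mr)
    (hd : 'I_K -> R[i]) (P : 'I_K -> R) (u : 'rV[R[i]]_Mr) :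
  let x k := (u *m hr k) 0 0 in
  (u *m Wmx hr hd P *m adjmx u) 0 0
  = 2^-1 * \sum_j \sum_k (P j * P k)%:C *
      ((hd k * x j - hd j * x k) * Num.conj (hd k * x j - hd j * x k)).
Proof.
move=> x; rewrite /Wmx -scalemxAr -scalemxAl mxE; congr (_ * _).
rewrite mulmx_sumr mulmx_suml summxE; apply: eq_bigr => j _.
rewrite mulmx_sumr mulmx_suml summxE; apply: eq_bigr => k _.
rewrite -scalemxAr -scalemxAl mxE quad_outer.
suff -> : (u *m (hd k *: hr j - hd j *: hr k)) 0 0
    = hd k * x j - hd j * x k by [].
by rewrite mulmxBr -!scalemxAr [LHS]mxE [X in _ + X]mxE [X in X - _]mxE [X in _ - X]mxE.
Qed.

Lemma adjmx_outer (R : realType) n (a : 'cV[R[i]]_n) :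
  adjmx (a *m adjmx a) = a *m adjmx a.
Proof. by rewrite adjmxM adjmxK. Qed.

Lemma adjmx_RW (R : realType) (K Mr : nat) (hr : 'I_K -> 'cV[R[i]]_Mr)
    (hd : 'I_K -> R[i]) (P : 'I_K -> R) :
  adjmx (Rmx hr P + Wmx hr hd P) = Rmx hr P + Wmx hr hd P.
Proof.
rewrite adjmxD /Rmx /Wmx adjmxZ !adjmx_sum; congr (_ + _ *: _).
- by apply: eq_bigr => k _; rewrite adjmxZ conj_real_complex adjmx_outer.
- by rewrite fmorphV rmorph_nat.
- apply: eq_bigr => j _; rewrite adjmx_sum; apply: eq_bigr => k _.
  by rewrite adjmxZ conj_real_complex adjmx_outer.
Qed.

Lemma quad_RW_ge0 (R : realType) (K Mr : nat) (hr : 'I_K -> 'cV[R[i]]_Mr)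
    (hd : 'I_K -> R[i]) (P : 'I_K -> R) (u : 'rV[R[i]]_Mr) :
  (forall k, 0 <= P k) ->
  0 <= (u *m (Rmx hr P + Wmx hr hd P) *m adjmx u) 0 0.
Proof.
move=> P0; rewrite mulmxDr mulmxDl mxE quad_Rmx quad_Wmx addr_ge0//.
  apply: sumr_ge0 => k _.
  by rewrite mulr_ge0 ?mul_conjC_ge0// real_complex_ge0.
rewrite mulr_ge0 ?invr_ge0 ?ler0n//; apply: sumr_ge0 => j _.
apply: sumr_ge0 => k _.
by rewrite mulr_ge0 ?mul_conjC_ge0// real_complex_ge0// mulr_ge0.
Qed.

(** The form of [Rmx + Wmx] is nonnegative; at an eigenvector for [lambda_max] it equals
    [lambda_max] times a positive number. *)
Lemma lambda_max_RW_ge0 (R : realType) (K Mr : nat)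
    (hr : 'I_K -> 'cV[R[i]]_Mr) (hd : 'I_K -> R[i]) (P : 'I_K -> R) :
  (0 < Mr)%N -> (forall k, 0 <= P k) ->
  0 <= lambda_max (Rmx hr P + Wmx hr hd P).
Proof.
move=> Mr0 P0.
have [/eigenvalueP[v vA v0] _] := hermitian_lambda_max Mr0 (adjmx_RW hr hd P).
have := quad_RW_ge0 hr hd v P0.
by rewrite vA -scalemxAl mxE pmulr_lge0 ?mulmx_adj_gt0// lecE/= eqxx.
Qed.

(** * Closed form of the joint sum-rate *)

Lemma det_mx22 (F : comNzRingType) (A : 'M[F]_2) :
  \det A = A 0 0 * A 1 1 - A 0 1 * A 1 0.
Proof.
rewrite (expand_det_row _ 0) !big_ord_recl big_ord0 addr0 /cofactor !det_mx11.
rewrite !mxE /= expr0 mul1r expr1 mulN1r mulrN.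
by congr (A _ _ * A _ _ - A _ _ * A _ _); apply/val_inj.
Qed.

Lemma ReZ (R : realType) (a : R) (z : R[i]) :
  complex.Re (a%:C * z) = a * complex.Re z.
Proof. by case: z => x y /=; rewrite mul0r subr0. Qed.

Lemma sum_rateE (R : realType) (K Mr : nat) (hr : 'I_K -> 'cV[R[i]]_Mr)
    (hd : 'I_K -> R[i]) (P : 'I_K -> R) (h : 'cV[R[i]]_Mr)
    (F : 'M[R[i]]_Mr) :
  let u := adjmx h *m F in
  sum_rate hr hd P h F =
  log2 (1 + \sum_k P k * cabs (hd k) ^+ 2
    + complex.Re ((u *m (Rmx hr P + Wmx hr hd P) *m adjmx u) 0 0)
      / (1 + complex.Re ((u *m adjmx u) 0 0))).
Proof.
move=> u; set n := complex.Re ((u *m adjmx u) 0 0).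
have n0 : 0 <= n by apply: Re_ge0; exact: mulmx_adj_ge0.
have rE : relay_noise h F = (1 + n)%:C.
  have -> : (1 + n)%:C = 1 + (u *m adjmx u) 0 0.
    by rewrite rmorphD rmorph1 /= RRe_real ?ger0_real ?mulmx_adj_ge0.
  by rewrite /relay_noise /u adjmxM adjmxK !mulmxA.
pose s := (sqrtC (relay_noise h F))^-1.
have r0 : 0 <= relay_noise h F by rewrite rE real_complex_ge0// addr_ge0.
have ss : s * Num.conj s = ((1 + n)^-1)%:C.
  have /CrealP -> : s \is Num.real by rewrite rpredV sqrtC_real.
  by rewrite -expr2 exprVn sqrtCK rE fmorphV.
(* The noise normalisation [s] is absorbed into the row, so that the formulas for the quadratic
   forms apply to [s *: u] as a whole; afterwards it comes out as [s * conj s = 1 / (1 + n)]. *)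
pose x k := ((s *: u) *m hr k) 0 0.
have xE k : x k = s * (u *m hr k) 0 0 by rewrite /x -scalemxAl mxE.
rewrite /sum_rate; congr log2.
set M := _ + \sum_(k < K) _.
have heE k i : h_eff hr hd h F k i 0 = if i == 0 then x k else hd k.
  by rewrite mxE xE.
have ME i j : M i j = (i == j)%:R + \sum_k (P k)%:C *
    ((if i == 0 then x k else hd k) *
     Num.conj (if j == 0 then x k else hd k)).
  rewrite /M mxE mxE summxE; congr (_ + _); apply: eq_bigr => k _.
  by rewrite mxE mxE big_ord1 [X in _ * (_ * X)]mxE [X in Num.conj X]mxE !heE.
rewrite det_mx22 !ME /= !add0r.
rewrite (lagrange_identity (fun k => (P k)%:C) x (fun k => Num.conj (x k))
  hd (fun k => Num.conj (hd k))).
set Q := Rmx hr P + Wmx hr hd P.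
have suE : \sum_k (P k)%:C * (x k * Num.conj (x k)) +
    2^-1 * \sum_j \sum_k (P j)%:C * (P k)%:C *
      ((hd k * x j - hd j * x k) *
       (Num.conj (hd k) * Num.conj (x j) - Num.conj (hd j) * Num.conj (x k)))
    = ((1 + n)^-1)%:C * (u *m Q *m adjmx u) 0 0.
  transitivity (((s *: u) *m Q *m adjmx (s *: u)) 0 0); last first.
    by rewrite adjmxZ -scalemxAr -!scalemxAl scalerA mxE [_ * s]mulrC ss.
  rewrite /Q mulmxDr mulmxDl mxE quad_Rmx quad_Wmx; congr (_ + _ * _).
  apply: eq_bigr => j _; apply: eq_bigr => k _.
  by rewrite rmorphB !rmorphM.
have dE : 1 + \sum_k (P k)%:C * (hd k * Num.conj (hd k))
    = (1 + \sum_k P k * cabs (hd k) ^+ 2)%:C.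
  rewrite rmorphD rmorph1 rmorph_sum; congr (_ + _); apply: eq_bigr => k _.
  by rewrite rmorphM -cabs_sqr.
by rewrite suE dE raddfD /= ReZ [X in _ + X]mulrC.
Qed.

(** * Logarithms and limits at infinity *)

Lemma ln2_gt0 (R : realType) : 0 < ln 2 :> R.
Proof. by rewrite ln_gt0// ltr1n. Qed.

Lemma le_log2 (R : realType) (x y : R) : 0 < x -> x <= y -> log2 x <= log2 y.
Proof.
move=> x0 xy; rewrite /log2 ler_pM2r ?invr_gt0 ?ln2_gt0// ler_ln//.
by rewrite posrE (lt_le_trans x0).
Qed.

Lemma lt_log2 (R : realType) (x y : R) :
  0 < x -> 0 < y -> (log2 x < log2 y) = (x < y).
Proof. by move=> x0 y0; rewrite /log2 ltr_pM2r ?invr_gt0 ?ln2_gt0// ltr_ln. Qed.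

Lemma cvg_log2 (R : realType) (f : R -> R) (F : set_system R) (l : R) :
  Filter F -> 0 < l -> f x @[x --> F] --> l ->
  log2 (f x) @[x --> F] --> log2 l.
Proof.
move=> FF l0 fl; apply: cvgM; last exact: cvg_cst.
by apply: continuous_cvg => //; exact: continuous_ln.
Qed.

Lemma cvg_sumr (R : realType) (T : Type) (F : set_system T) (I : Type)
    (r : seq I) (f : I -> T -> R) (l : I -> R) :
  Filter F -> (forall k, f k x @[x --> F] --> l k) ->
  \sum_(k <- r) f k x @[x --> F] --> \sum_(k <- r) l k.
Proof.
move=> FF fl; elim: r => [|k r IH].
  by rewrite big_nil; under eq_cvg do rewrite big_nil; exact: cvg_cst.
by rewrite big_cons; under eq_cvg do rewrite big_cons; exact: cvgD.
Qed.

(** Where [a x + b] is nonzero, the quotient equals [1/a - (b/a) / (a x + b)]. Both rate limits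
    reduce to this one. *)
Lemma cvg_div_affine (R : realType) (a b : R) :
  0 < a -> x / (a * x + b) @[x --> +oo] --> a^-1.
Proof.
move=> a0.
have pos : \forall x \near (+oo : set_system R), 0 < a * x + b.
  near=> x; rewrite -ltrBlDr sub0r -ltr_pdivrMl//.
  by near: x; apply: nbhs_pinfty_gt; rewrite num_real.
have yoo : a * x + b @[x --> +oo] --> (+oo : set_system R).
  apply/cvgryPgt => A; near=> x; rewrite -ltrBlDr -ltr_pdivrMl//.
  by near: x; apply: nbhs_pinfty_gt; rewrite num_real.
have inv0 : (a * x + b)^-1 @[x --> +oo] --> (0 : R) by apply/gtr0_cvgV0.
have lim : a^-1 - a^-1 * b * (a * x + b)^-1 @[x --> +oo] --> a^-1.
  rewrite -[X in _ --> X]subr0 -(mulr0 (a^-1 * b)).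
  by apply: cvgB; [exact: cvg_cst|apply: cvgM => //; exact: cvg_cst].
apply: cvg_trans lim; apply: near_eq_cvg; near=> x.
have y0 : a * x + b != 0 by rewrite gt_eqF//; near: x.
by field; rewrite y0 gt_eqF.
Unshelve. all: by end_near. Qed.

(** * Limit of the joint sum-rate *)

Section joint.
Variables (R : realType) (K Mr : nat) (hr : 'I_K -> 'cV[R[i]]_Mr).
Variables (hd : 'I_K -> R[i]) (P : 'I_K -> R) (h : 'cV[R[i]]_Mr).
Hypotheses (Mr0 : (0 < Mr)%N) (P0 : forall k, 0 <= P k) (h0 : h != 0).

Let D := \sum_k P k * cabs (hd k) ^+ 2.
Let Q := Rmx hr P + Wmx hr hd P.
Let L := lambda_max Q.

Let D0 : 0 <= D.
Proof. by apply: sumr_ge0 => k _; rewrite mulr_ge0// sqr_ge0. Qed.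

Let L0 : 0 <= L. Proof. exact: lambda_max_RW_ge0. Qed.

(** The Rayleigh bound gives [q <= L n], and [L n <= L (1 + n)] because [L >= 0]. The bound is
    uniform in [F]. *)
Lemma sum_rate_le F : sum_rate hr hd P h F <= log2 (1 + D + L).
Proof.
rewrite sum_rateE -/D -/Q; set u := adjmx h *m F.
set q := complex.Re _; set n := complex.Re _.
have n0 : 0 <= n by apply: Re_ge0; exact: mulmx_adj_ge0.
have q0 : 0 <= q by apply: Re_ge0; exact: quad_RW_ge0.
have qL : q <= L * n.
  have [_ /(_ u)] := hermitian_lambda_max Mr0 (adjmx_RW hr hd P).
  by rewrite lecE => /andP[_]; rewrite ReZ.
have n1 : 0 < 1 + n by rewrite ltr_pwDl.
apply: le_log2; first by rewrite ltr_pwDl ?divr_ge0 ?(ltW n1)// ltr_pwDl.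
by rewrite lerD2l ler_pdivrMr// mulrDr mulr1 (le_trans qL)// lerDr.
Qed.

Lemma joint_feasible0 (Pr : R) : 0 <= Pr -> joint_feasible hr P Pr 0.
Proof.
by move=> Pr0; rewrite /joint_feasible/= !mul0mx mxtrace0 real_complex_ge0.
Qed.

Lemma joint_sum_rate_le (Pr : R) :
  0 <= Pr -> joint_sum_rate hr hd P h Pr <= log2 (1 + D + L).
Proof.
move=> Pr0; apply: ge_sup; last by move=> _ [F _ <-]; exact: sum_rate_le.
by exists (sum_rate hr hd P h 0), 0 => //; exact: joint_feasible0.
Qed.

(** The trace splits into [tr (G G^H)] and the terms [P_k tr ((G hr_k) (G hr_k)^H)]. *)
Lemma mxtrace_power_ge0 (G : 'M[R[i]]_Mr) :
  0 <= \tr (G *m (1%:M + Rmx hr P) *m adjmx G).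
Proof.
rewrite mulmxDr mulmxDl mxtraceD mulmx1 addr_ge0 ?mxtrace_mulmx_adj_ge0//.
rewrite /Rmx mulmx_sumr mulmx_suml raddf_sum; apply: sumr_ge0 => k _.
rewrite -scalemxAr -scalemxAl /= mxtraceZ mulr_ge0 ?real_complex_ge0//.
by rewrite mulmxA -(mulmxA (G *m hr k)) -adjmxM mxtrace_mulmx_adj_ge0.
Qed.

Lemma joint_sum_rate_ge : exists2 a : R, 0 < a & forall Pr : R, 0 <= Pr ->
  log2 (1 + D + L * a * (Pr / (a * Pr + 1))) <= joint_sum_rate hr hd P h Pr.
Proof.
have [/eigenvalueP[v vQ v0] _] := hermitian_lambda_max Mr0 (adjmx_RW hr hd P).
pose H := complex.Re ((adjmx h *m h) 0 0).
have hh := adj_mulmx_gt0 h0.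
have vv := mulmx_adj_gt0 v0.
pose V := complex.Re ((v *m adjmx v) 0 0).
have HE : (adjmx h *m h) 0 0 = H%:C by rewrite /H RRe_real// gtr0_real.
have VE : (v *m adjmx v) 0 0 = V%:C by rewrite /V RRe_real// gtr0_real.
have H0 : 0 < H by rewrite -ltcR -HE.
have V0 : 0 < V by rewrite -ltcR -VE.
pose G := h *m v; pose T := complex.Re (\tr (G *m (1%:M + Rmx hr P) *m adjmx G)).
have TE : \tr (G *m (1%:M + Rmx hr P) *m adjmx G) = T%:C.
  by rewrite /T RRe_real// ger0_real// mxtrace_power_ge0.
have T0 : 0 <= T by apply: Re_ge0; exact: mxtrace_power_ge0.
(* Chosen so that the row [u = c H v] satisfies [|u|^2 = c^2 H^2 V = a Pr]. *)
exists (H ^+ 2 * V / (T + 1)); first by rewrite divr_gt0 ?mulr_gt0 ?ltr_wpDl.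
move=> Pr Pr0; set a := _ / _.
(* The matrix [c G] uses power [c^2 T]. Dividing by [T + 1] keeps this at most [Pr] and makes the
   denominator positive from [T >= 0] alone. *)
pose c := Num.sqrt (Pr / (T + 1)).
have cc : c ^+ 2 = Pr / (T + 1) by rewrite sqr_sqrtr// divr_ge0// addr_ge0.
have uE : adjmx h *m (c%:C *: G) = (c * H)%:C *: v.
  rewrite -scalemxAr mulmxA [adjmx h *m h]mx11_scalar HE mul_scalar_mx.
  by rewrite scalerA rmorphM.
have -> : log2 (1 + D + L * a * (Pr / (a * Pr + 1)))
    = sum_rate hr hd P h (c%:C *: G).
  have adjcv b : adjmx (b%:C *: v) = b%:C *: adjmx v.
    by rewrite adjmxZ conj_real_complex.
  rewrite sum_rateE uE -/D -/Q adjcv -!scalemxAl -!scalemxAr vQ -scalemxAl.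
  rewrite -/Q -/L [v *m _]mx11_scalar VE !scale_scalar_mx !mxE !mulr1n.
  rewrite !ReZ /=; congr (log2 (_ + _)).
  have -> : c * H * (c * H * (L * V)) = L * (a * Pr).
    by transitivity (c ^+ 2 * (H ^+ 2 * V * L)); [ring|rewrite cc /a; ring].
  have -> : c * H * (c * H * V) = a * Pr.
    by transitivity (c ^+ 2 * (H ^+ 2 * V)); [ring|rewrite cc /a; ring].
  by rewrite [1 + a * Pr]addrC !mulrA.
apply: ub_le_sup.
  by exists (log2 (1 + D + L)) => _ [F _ <-]; exact: sum_rate_le.
exists (c%:C *: G) => //; rewrite /joint_feasible/=.
rewrite adjmxZ conj_real_complex -!scalemxAl -!scalemxAr scalerA mxtraceZ TE.
rewrite -!rmorphM /= lecR -expr2 cc mulrAC ler_pdivrMr ?ltr_wpDl//.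
by rewrite ler_wpM2l// lerDl.
Qed.

Lemma cvg_joint_sum_rate :
  joint_sum_rate hr hd P h Pr @[Pr --> +oo] --> log2 (1 + D + L).
Proof.
have [a a0 Ja] := joint_sum_rate_ge.
apply: (@squeeze_cvgr _ _ _ _
  (fun Pr => log2 (1 + D + L * a * (Pr / (a * Pr + 1))))
  (fun=> log2 (1 + D + L))); last 2 first.
- apply: cvg_log2; first by rewrite ltr_pwDl// ltr_pwDl.
  apply: cvgD; first exact: cvg_cst.
  rewrite -[X in _ --> X](mulfK (lt0r_neq0 a0)).
  by apply: cvgM; [exact: cvg_cst|exact: cvg_div_affine].
- exact: cvg_cst.
- near=> Pr.
  have Pr0 : 0 <= Pr by near: Pr; apply: nbhs_pinfty_ge; rewrite num_real.
  by rewrite Ja// joint_sum_rate_le.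
Unshelve. all: by end_near. Qed.

End joint.

(** * Limit of the TDMA sum-rate *)

Section tdma.
Variables (R : realType) (K Mr : nat) (hr : 'I_K -> 'cV[R[i]]_Mr).
Variables (hd : 'I_K -> R[i]) (P : 'I_K -> R) (h : 'cV[R[i]]_Mr).
Hypotheses (K0 : (0 < K)%N) (P0 : forall k, 0 <= P k) (h0 : h != 0).

Let c k := P k * (cabs (hd k) ^+ 2 + l2norm (hr k) ^+ 2).
Let C := \sum_k c k.

Let c_ge0 k : 0 <= c k.
Proof. by rewrite mulr_ge0// addr_ge0 ?sqr_ge0. Qed.

Let C_ge0 : 0 <= C. Proof. by apply: sumr_ge0 => k _. Qed.

(** The denominator of the relay term is at least [|h|^2 Pr tau], so that term is at most
    [P_k |hr_k|^2 / tau]. For [tau = 0] both sides vanish. *)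
Lemma tdma_rate_le (Pr : R) k (tau : R) : 0 <= Pr -> 0 <= tau ->
  tdma_rate hr hd P h Pr k tau <= tau * log2 (1 + c k / tau).
Proof.
move=> Pr0; rewrite le_eqVlt => /orP[/eqP<-|t0].
  by rewrite /tdma_rate eqxx mul0r.
rewrite /tdma_rate gt_eqF// ler_pM2l// /c.
have A0 := sqr_ge0 (cabs (hd k)); have B0 := sqr_ge0 (l2norm (hr k)).
have H0 := l2norm_gt0 h0.
move: (cabs _ ^+ 2) (l2norm (hr k) ^+ 2) (l2norm h ^+ 2) (P k) (P0 k) A0 B0 H0.
move=> A B H p p0 A0 B0 H0.
have pB0 : 0 <= p * B by rewrite mulr_ge0.
have den0 : 0 < H * Pr * tau + p * B + tau.
  by rewrite ltr_wpDl// addr_ge0// !mulr_ge0// ltW.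
apply: le_log2.
  rewrite ltr_pwDl// ?divr_ge0 ?(ltW den0)// ?ltr_pwDl// ?divr_ge0 ?mulr_ge0//;
  exact: ltW.
rewrite -addrA lerD2l mulrDr mulrDl [A * p]mulrC lerD2l.
rewrite ler_pdivrMr// [leRHS]mulrAC ler_pdivlMr//.
have -> : H * p * B * Pr * tau = p * B * (H * Pr * tau) by ring.
by rewrite ler_wpM2l// -addrA lerDl addr_ge0// ltW.
Qed.

Lemma cvg_tdma_rate k (tau : R) : 0 <= tau ->
  tdma_rate hr hd P h Pr k tau @[Pr --> +oo] --> tau * log2 (1 + c k / tau).
Proof.
rewrite le_eqVlt => /orP[/eqP<-|t0].
  rewrite /tdma_rate mul0r; under eq_cvg do rewrite eqxx.
  exact: cvg_cst.
rewrite /tdma_rate; under eq_cvg do rewrite gt_eqF//.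
have H0 := l2norm_gt0 h0.
have ck := c_ge0 k.
apply: cvgM; first exact: cvg_cst.
apply: cvg_log2; first by rewrite ltr_pwDl// divr_ge0// ltW.
(* The factor [|h|^2] is put back above and below, to match the limit of [x / (a x + b)] with
   [a = |h|^2 tau]. *)
have -> : 1 + c k / tau = 1 + cabs (hd k) ^+ 2 * P k / tau +
    l2norm h ^+ 2 * P k * l2norm (hr k) ^+ 2 * (l2norm h ^+ 2 * tau)^-1.
  by rewrite /c; field; rewrite gt_eqF//= -sqrf_eq0 gt_eqF.
have lim := cvg_div_affine (P k * l2norm (hr k) ^+ 2 + tau) (mulr_gt0 H0 t0).
under eq_cvg => x do
  rewrite -[_ * x / _]mulrA [_ * x * tau]mulrAC -[_ + _ + tau]addrA.
by apply: cvgD; [exact: cvg_cst|apply: cvgM lim; exact: cvg_cst].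
Qed.

(* Tangent line of [ln] at [1 + C], the common value of [1 + c k / tau k] at
   the optimal allocation. *)
Lemma tdma_limit_rate_le (tau : 'I_K -> R) : time_allocation tau ->
  \sum_k tau k * log2 (1 + c k / tau k) <= log2 (1 + C).
Proof.
move=> [tau0 tau1].
have C1 : 0 < 1 + C by rewrite ltr_pwDl.
under eq_bigr do rewrite /log2 mulrA.
rewrite -mulr_suml ler_pM2r ?invr_gt0 ?ln2_gt0//.
(* Multiplied by [tau k], the tangent bound also covers [tau k = 0]. Summed over [k], the last two
   terms become [(1 + C) / (1 + C) - 1 = 0]. *)
have tangent k : tau k * ln (1 + c k / tau k) <=
    tau k * ln (1 + C) + (tau k + c k) / (1 + C) - tau k.
  have := tau0 k; rewrite le_eqVlt => /orP[/eqP<-|t0].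
    by rewrite !mul0r !add0r subr0 divr_ge0// ltW.
  have x0 : 0 < 1 + c k / tau k by rewrite ltr_pwDl// divr_ge0.
  have : ln ((1 + c k / tau k) / (1 + C)) <= (1 + c k / tau k) / (1 + C) - 1.
    rewrite -{1}[X in ln X](subrK 1) addrC le_ln1Dx//.
    by rewrite ltrBrDl subrr divr_gt0.
  rewrite ln_div// lerBlDr => /(ler_wpM2l (ltW t0))/le_trans; apply.
  by rewrite le_eqVlt; apply/orP; left; apply/eqP; field; rewrite !gt_eqF.
apply: (le_trans (ler_sum _ (fun k _ => tangent k))).
rewrite sumrB big_split/= -!mulr_suml tau1 mul1r big_split/= tau1.
by rewrite divff ?gt_eqF// addrK.
Qed.

Lemma tdma_optimal_allocation : exists2 tau : 'I_K -> R, time_allocation tau &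
  \sum_k tau k * log2 (1 + c k / tau k) = log2 (1 + C).
Proof.
(* If [C = 0], every [c k] vanishes and all rates are 0, so the whole frame may go to one user.
   Otherwise [tau k = c k / C] turns each [1 + c k / tau k] with [c k != 0] into [1 + C]. *)
have := C_ge0; rewrite le_eqVlt => /orP[/eqP C0|C0].
  have c0 k : c k = 0.
    move/esym/eqP: C0; rewrite psumr_eq0// => /allP/(_ k (mem_index_enum _)).
    by move/eqP.
  exists (fun k => (k == Ordinal K0)%:R).
    split=> [k|]; first exact: ler0n.
    rewrite (bigD1 (Ordinal K0))//= big1 ?addr0// => k /negbTE->.
    by rewrite mulr0n.
  have log0 : log2 (1 + 0) = 0 :> R by rewrite addr0 /log2 ln1 mul0r.
  by rewrite -C0 log0 big1// => k _; rewrite c0 mul0r log0 mulr0.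
exists (fun k => c k / C); last first.
  transitivity (\sum_k c k / C * log2 (1 + C)).
    apply: eq_bigr => k _; have [->|ck] := eqVneq (c k) 0.
      by rewrite !mul0r.
    by rewrite invf_div [c k * (_ / _)]mulrC divfK.
  by rewrite -!mulr_suml divff ?mul1r// gt_eqF.
split=> [k|]; first by rewrite divr_ge0// ltW.
by rewrite -mulr_suml divff// gt_eqF.
Qed.

Lemma tdma_sum_le (Pr : R) tau : 0 <= Pr -> time_allocation tau ->
  \sum_k tdma_rate hr hd P h Pr k (tau k) <= log2 (1 + C).
Proof.
move=> Pr0 tauP; apply: le_trans (tdma_limit_rate_le tauP).
by apply: ler_sum => k _; apply: tdma_rate_le => //; case: tauP.
Qed.

(** The allocation optimal for the limiting rates is held fixed while [Pr] grows; its sum-rate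
    converges to the bound valid at every [Pr >= 0]. This squeeze replaces an exchange of limit and
    supremum. *)
Lemma cvg_tdma_sum_rate :
  tdma_sum_rate hr hd P h Pr @[Pr --> +oo] --> log2 (1 + C).
Proof.
have [tau tauP tauE] := tdma_optimal_allocation.
apply: (@squeeze_cvgr _ _ _ _
  (fun Pr => \sum_k tdma_rate hr hd P h Pr k (tau k))
  (fun=> log2 (1 + C))); last 2 first.
- rewrite -tauE; apply: cvg_sumr => k; apply: cvg_tdma_rate.
  by case: tauP.
- exact: cvg_cst.
- near=> Pr.
  have Pr0 : 0 <= Pr by near: Pr; apply: nbhs_pinfty_ge; rewrite num_real.
  apply/andP; split.
    apply: ub_le_sup; last by exists tau.
    by exists (log2 (1 + C)) => _ [t tP <-]; exact: tdma_sum_le.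
  apply: ge_sup; last by move=> _ [t tP <-]; exact: tdma_sum_le.
  by eexists; exists tau.
Unshelve. all: by end_near. Qed.

End tdma.

(** * Comparison of the two limits *)

Theorem theorem1 (R : realType) (K Mr : nat) (hr : 'I_K -> 'cV[R[i]]_Mr)
    (hd : 'I_K -> R[i]) (P : 'I_K -> R) (h : 'cV[R[i]]_Mr) :
  (1 <= K)%N -> (1 <= Mr)%N -> (forall k, 0 <= P k) -> h != 0 ->
  [/\ cvg (joint_sum_rate hr hd P h Pr @[Pr --> +oo]),
      cvg (tdma_sum_rate hr hd P h Pr @[Pr --> +oo]) &
      lim (joint_sum_rate hr hd P h Pr @[Pr --> +oo])
        > lim (tdma_sum_rate hr hd P h Pr @[Pr --> +oo]) <->
      lambda_max (Rmx hr P + Wmx hr hd P)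
        > \sum_(k < K) l2norm (hr k) ^+ 2 * P k].
Proof.
move=> K0 Mr0 P0 h0.
have J := @cvg_joint_sum_rate R K Mr hr hd P h Mr0 P0 h0.
have T := @cvg_tdma_sum_rate R K Mr hr hd P h K0 P0 h0.
split; [by apply/cvg_ex; eexists; exact: J|by apply/cvg_ex; eexists; exact: T|].
rewrite (cvg_lim _ J)// (cvg_lim _ T)//.
have D0 : 0 <= \sum_k P k * cabs (hd k) ^+ 2.
  by apply: sumr_ge0 => k _; rewrite mulr_ge0// sqr_ge0.
have B0 : 0 <= \sum_k l2norm (hr k) ^+ 2 * P k.
  by apply: sumr_ge0 => k _; rewrite mulr_ge0// sqr_ge0.
have L0 := @lambda_max_RW_ge0 R K Mr hr hd P Mr0 P0.
(* The direct-link part is split off. It occurs in both limits and cancels once the strictly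
   increasing [log2] is removed. *)
have -> : 1 + \sum_k P k * (cabs (hd k) ^+ 2 + l2norm (hr k) ^+ 2)
    = 1 + \sum_k P k * cabs (hd k) ^+ 2 + \sum_k l2norm (hr k) ^+ 2 * P k.
  rewrite -addrA -big_split/=; congr (_ + _); apply: eq_bigr => k _.
  by rewrite mulrDr [P k * l2norm _ ^+ 2]mulrC.
by rewrite lt_log2 ?ltrD2l// ltr_pwDl// ltr_pwDl.
Qed.
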